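(* For every metric space $(X,d)$, we have $$\underline{\dim}_{\zeta} X\le \overline{\dim}_{\zeta} X\le \dim_{\mathrm{A}} X.$$
   Context: Let $(X,d)$ be a (nonempty) metric space and fix $\alpha\in X$. $B(x,R)$ denotes the closed ball centered at $x$ with radius $R>0$. For $E\subseteq X$ and $r>0$, $N(E,r)$ denotes the smallest number of sets of diameter at most $r$ required to cover $E$ ($N(E,r)=\infty$ if no finite such cover exists). Conventions for subsets of $[0,\infty)$: $\inf\emptyset=\infty$, $\sup\emptyset=0$, and $\sup A=\infty$ if $A$ is unbounded. All dimensions take values in $[0,\infty]$. For $F\subseteq X$, the upper zeta dimension is $$\overline{\dim}_{\zeta}F=\lim_{r\to\infty}\inf\Big\{\sigma\ge 0 : \exists C>0\ \exists R_0>0\ \forall R\ge R_0\ \ N\big(B(\alpha,R)\cap F,r\big)\le C R^{\sigma}\Big\},$$ and the lower zeta dimension is $$\underline{\dim}_{\zeta}F=\lim_{r\to\infty}\sup\Big\{\sigma\ge 0 : \exists C>0\ \exists R_0>0\ \forall R\ge R_0\ \ N\big(B(\alpha,R)\cap F,r\big)\ge C R^{\sigma}\Big\}.$$ The limits exist in $[0,\infty]$ and do not depend on $\alpha\in X$. For $F\subseteq X$, the Assouad dimension is $$\dim_{\mathrm{A}}F=\inf\Big\{\sigma\ge 0:\exists C>0\ \forall r>0\ \forall R>r\ \forall x\in F\ \ N\big(B(x,R)\cap F,r\big)\le C\Big(\frac{R}{r}\Big)^{\sigma}\Big\}.$$ *)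

(* Defs.v *)
From HB Require Import structures.
From mathcomp Require Import all_boot all_order all_algebra.
From mathcomp Require Import all_classical all_reals all_analysis.

Set Implicit Arguments.
Unset Strict Implicit.
Unset Printing Implicit Defensive.

Import Order.TTheory GRing.Theory Num.Theory.
Import numFieldNormedType.Exports.

Local Open Scope classical_set_scope.
Local Open Scope ring_scope.

Section zeta_dimensions.
Context {R : realType} {X : metricType R}.
Implicit Types (E F A : set X) (x alpha : X) (r rho sigma : R).

(* Not [closed_ball], which is the closure of the open ball and can be strictly
   smaller in a general metric space. *)
Definition metric_cball x rho : set X := [set y | mdist x y <= rho].

(* Supremum of a set of nonnegative extended reals, with sup set0 = 0 instead
   of [ereal_sup set0 = -oo]. *)
Definition sup_nneg (S : set (\bar R)) : \bar R := maxe 0%E (ereal_sup S).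

Definition diam A : \bar R :=
  sup_nneg [set (mdist p.1 p.2)%:E | p in A `*` A].

Definition has_cover E r (n : nat) : Prop :=
  exists U : 'I_n -> set X,
    (forall i, (diam (U i) <= r%:E)%E) /\ E `<=` \bigcup_i U i.

(* The infimum is a minimum when a finite cover exists, and +oo otherwise. *)
Definition cover_number E r : \bar R :=
  ereal_inf [set n%:R%:E | n in has_cover E r].

Definition upper_zeta_exponents alpha F r : set R :=
  [set sigma | 0 <= sigma /\
    exists C : R, 0 < C /\ exists rho0 : R, 0 < rho0 /\
      forall rho, rho0 <= rho ->
        (cover_number (metric_cball alpha rho `&` F) r
           <= (C * rho `^ sigma)%:E)%E].

Definition lower_zeta_exponents alpha F r : set R :=
  [set sigma | 0 <= sigma /\
    exists C : R, 0 < C /\ exists rho0 : R, 0 < rho0 /\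
      forall rho, rho0 <= rho ->
        ((C * rho `^ sigma)%:E
           <= cover_number (metric_cball alpha rho `&` F) r)%E].

(* Both limits exist in \bar R: [cover_number E r] is nonincreasing in r, hence so
   are the two functions of r below. *)
Definition upper_zeta_dim alpha F : \bar R :=
  lim (ereal_inf (EFin @` upper_zeta_exponents alpha F r) @[r --> +oo]).

Definition lower_zeta_dim alpha F : \bar R :=
  lim (sup_nneg (EFin @` lower_zeta_exponents alpha F r) @[r --> +oo]).

Definition assouad_exponents F : set R :=
  [set sigma | 0 <= sigma /\
    exists C : R, 0 < C /\
      forall r, 0 < r -> forall rho, r < rho -> forall x, F x ->
        (cover_number (metric_cball x rho `&` F) r
           <= (C * (rho / r) `^ sigma)%:E)%E].

Definition assouad_dim F : \bar R := ereal_inf (EFin @` assouad_exponents F).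

End zeta_dimensions.

(* Main.v *)
Require Import Defs.
From mathcomp Require Import all_boot all_order all_algebra.
From mathcomp Require Import all_classical all_reals all_analysis.

(** Both inequalities hold at every fixed scale [r] and pass to the limit.

    At scale [r], a lower exponent [sigma] and an upper exponent [tau] give
    [C * rho ^ sigma <= C' * rho ^ tau] for all large [rho], which forces
    [sigma <= tau] ([powR_growth_le]); hence the supremum of the lower
    exponents is at most the infimum of the upper ones
    ([lower_le_upper_at_scale]).

    An Assouad exponent [sigma] bounds the covering number of the ball of radius
    [rho] about [alpha] by [C * (rho / r) ^ sigma], and for fixed [r] the factor
    [r ^ (- sigma)] is a constant that [C] can absorb. So [sigma] is an upper
    exponent at every scale [r > 0] ([assouad_exponents_sub_upper]): the Assouad
    condition asks for one constant uniform in scale and centre, the zeta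
    condition allows a constant depending on [r].

    What lets the comparison pass to the limit is that covering numbers are
    nonincreasing in [r], so that both dimensions at scale [r] are nonincreasing
    in [r] and therefore converge in the extended reals. *)

Set Implicit Arguments.
Unset Strict Implicit.
Unset Printing Implicit Defensive.

Import Order.TTheory GRing.Theory Num.Theory.
Import numFieldNormedType.Exports.

Local Open Scope classical_set_scope.
Local Open Scope ring_scope.

Lemma powR_growth_le (R : realType) (C C' rho0 sigma tau : R) :
  0 < C ->
  (forall rho, rho0 <= rho -> C * rho `^ sigma <= C' * rho `^ tau) ->
  sigma <= tau.
Proof.
move=> C_gt0 bound; rewrite leNgt; apply/negP => tau_lt.
have d_gt0 : 0 < sigma - tau by rewrite subr_gt0.
(* Now [rho ^ (sigma - tau)] is at most [C' / C] for all large [rho]; the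
   contradiction comes from a [rho] at which this power reaches [M > C' / C]. *)
pose M := `|C' / C| + 1.
have M_gt0 : 0 < M by rewrite ltr_wpDl.
pose rho := Num.max rho0 (M `^ (sigma - tau)^-1).
have root_gt0 : 0 < M `^ (sigma - tau)^-1 by rewrite powR_gt0.
have rho_gt0 : 0 < rho by rewrite /rho lt_max root_gt0 orbT.
have M_le : M <= rho `^ (sigma - tau).
  rewrite -[leLHS](powRr1 (ltW M_gt0)) -(mulVf (lt0r_neq0 d_gt0)) powRrM.
  by rewrite ge0_ler_powR ?nnegrE ?(ltW d_gt0) ?(ltW root_gt0) ?(ltW rho_gt0)//
    /rho le_max lexx orbT.
have rho_ge : rho0 <= rho by rewrite /rho le_max lexx.
have := bound _ rho_ge.
rewrite -{1}(subrK tau sigma) powRD; last by rewrite (gt_eqF rho_gt0) implybT.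
rewrite mulrA ler_pM2r ?powR_gt0// mulrC -ler_pdivlMr// => rho_le.
have := le_trans M_le rho_le.
by rewrite leNgt (le_lt_trans (ler_norm _))// /M ltrDl.
Qed.

Section zeta_dimensions_at_scale.
Context {R : realType} {X : metricType R}.
Implicit Types (E F : set X) (alpha : X) (r : R).

Lemma cover_number_nonincreasing E :
  {homo cover_number E : r s / r <= s >-> (s <= r)%E}.
Proof.
move=> r s rs; apply: ereal_inf_le_tmp => _ [n [U [dU EU]] <-].
exists n => //; exists U; split=> // i.
by rewrite (le_trans (dU i))// lee_fin.
Qed.

Lemma sup_nneg_le (S T : set (\bar R)) :
  S `<=` T -> (sup_nneg S <= sup_nneg T)%E.
Proof.
move=> ST; rewrite /sup_nneg ge_max le_max lexx/= le_max.
by rewrite (ereal_sup_le ST) orbT.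
Qed.

Lemma upper_zeta_at_scale_nonincreasing alpha F :
  {homo (fun r => ereal_inf (EFin @` upper_zeta_exponents alpha F r))
    : r s / r <= s >-> (s <= r)%E}.
Proof.
move=> r s rs; apply: ereal_inf_le_tmp; apply: image_subset.
move=> sigma [s0 [C [C0 [rho0 [rho00 bound]]]]].
split=> //; exists C; split=> //; exists rho0; split=> // rho rho_ge.
exact: le_trans (cover_number_nonincreasing _ rs) (bound _ rho_ge).
Qed.

Lemma lower_zeta_at_scale_nonincreasing alpha F :
  {homo (fun r => sup_nneg (EFin @` lower_zeta_exponents alpha F r))
    : r s / r <= s >-> (s <= r)%E}.
Proof.
move=> r s rs; apply: sup_nneg_le; apply: image_subset.
move=> sigma [s0 [C [C0 [rho0 [rho00 bound]]]]].
split=> //; exists C; split=> //; exists rho0; split=> // rho rho_ge.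
exact: le_trans (bound _ rho_ge) (cover_number_nonincreasing _ rs).
Qed.

Lemma lower_le_upper_at_scale alpha F r :
  (sup_nneg (EFin @` lower_zeta_exponents alpha F r)
     <= ereal_inf (EFin @` upper_zeta_exponents alpha F r))%E.
Proof.
apply: le_ereal_inf_tmp => _ [tau [tau0 [C' [_ [rho0' [_ upper]]]]] <-].
rewrite /sup_nneg ge_max lee_fin tau0/=.
apply: ge_ereal_sup => _ [sigma [_ [C [C0 [rho0 [_ lower]]]]] <-].
rewrite lee_fin; apply: (@powR_growth_le _ C C' (Num.max rho0 rho0')) => // rho.
rewrite ge_max => /andP[rho_ge rho_ge'].
by rewrite -lee_fin (le_trans (lower _ rho_ge)) ?upper.
Qed.

(** The ball that the zeta condition looks at is one of those in the Assouad
    condition because [alpha] lies in [F]; the constant becomes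
    [C * r ^ (- sigma)]. *)
Lemma assouad_exponents_sub_upper alpha F r : F alpha -> 0 < r ->
  assouad_exponents F `<=` upper_zeta_exponents alpha F r.
Proof.
move=> Falpha r0 sigma [sigma0 [C [C0 bound]]].
split=> //; exists (C * r^-1 `^ sigma); split.
  by rewrite mulr_gt0// powR_gt0// invr_gt0.
(* The Assouad bound needs [r < rho] strictly. *)
exists (r + 1); split; first by rewrite addr_gt0.
move=> rho rho_ge; have r_lt : r < rho by rewrite (lt_le_trans _ rho_ge)// ltrDl.
have := bound _ r0 _ r_lt _ Falpha.
by rewrite powRM ?invr_ge0 ?(ltW r0) ?(ltW (lt_trans r0 r_lt))// mulrAC mulrA.
Qed.

Lemma lower_zeta_dim_le_upper alpha F :
  (lower_zeta_dim alpha F <= upper_zeta_dim alpha F)%E.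
Proof.
apply: lee_lim.
- apply/cvg_ex; eexists.
  exact: nonincreasing_cvge (@lower_zeta_at_scale_nonincreasing alpha F).
- apply/cvg_ex; eexists.
  exact: nonincreasing_cvge (@upper_zeta_at_scale_nonincreasing alpha F).
- by apply: nearW => r; exact: lower_le_upper_at_scale.
Qed.

Lemma upper_zeta_dim_le_assouad alpha F : F alpha ->
  (upper_zeta_dim alpha F <= assouad_dim F)%E.
Proof.
move=> Falpha; apply: lime_le.
  apply/cvg_ex; eexists.
  exact: nonincreasing_cvge (@upper_zeta_at_scale_nonincreasing alpha F).
near=> r; apply: ereal_inf_le_tmp; apply: image_subset.
by apply: assouad_exponents_sub_upper.
Unshelve. all: by end_near. Qed.

End zeta_dimensions_at_scale.

Theorem theorem1p2 (R : realType) (X : metricType R) (alpha : X) :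
  (lower_zeta_dim alpha [set: X] <= upper_zeta_dim alpha [set: X])%E /\
  (upper_zeta_dim alpha [set: X] <= assouad_dim [set: X])%E.
Proof.
split; first exact: lower_zeta_dim_le_upper.
exact: upper_zeta_dim_le_assouad.
Qed.
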